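(* Let $A$ and $B$ be two asynchronously composable IOTSes such that both of the following conditions hold: (a) for all $(s_A,s_B)\in\mathit{reach}(A\otimes B^\rhd_{\mathit{out}_{BA}})$ and all $a\in\mathit{out}_{AB}$: if $s_A\xrightarrow{a}_A s_A'$ for some $s_A'$, then there exist $\bar s_B,s_B'$ with $s_B\ (\xrightarrow{\mathit{int}_B\cup\mathit{out}_{BA}^\rhd})^*_{B^\rhd_{\mathit{out}_{BA}}}\ \bar s_B\xrightarrow{a}_B s_B'$; (b) for all $(s_A,s_B)\in\mathit{reach}(A^\rhd_{\mathit{out}_{AB}}\otimes B)$ and all $b\in\mathit{out}_{BA}$: if $s_B\xrightarrow{b}_B s_B'$ for some $s_B'$, then there exist $\bar s_A,s_A'$ with $s_A\ (\xrightarrow{\mathit{int}_A\cup\mathit{out}_{AB}^\rhd})^*_{A^\rhd_{\mathit{out}_{AB}}}\ \bar s_A\xrightarrow{b}_A s_A'$. Then $A$ and $B$ are weakly asynchronously compatible.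
   Context: An IOTS $A=(\mathit{states}_A,\mathit{start}_A,\mathit{act}_A,\to_A)$ has states, initial state, actions $\mathit{act}_A=\mathit{in}_A\cup\mathit{out}_A\cup\mathit{int}_A$ (disjoint union of inputs, outputs, internal actions) and transitions $s\xrightarrow{a}_A s'$. $s\ (\xrightarrow{X})^*_A\ s'$ denotes a possibly empty finite sequence of transitions of $A$ labelled in $X$; $\mathit{reach}(A)$ is the set of states reachable from $\mathit{start}_A$. $A,B$ are composable if $\mathit{act}_A\cap\mathit{act}_B=(\mathit{in}_A\cap\mathit{out}_B)\cup(\mathit{in}_B\cap\mathit{out}_A)=:\mathit{shared}(A,B)$. Synchronous composition $A\otimes B$: states $\mathit{states}_A\times\mathit{states}_B$, initial $(\mathit{start}_A,\mathit{start}_B)$, inputs $(\mathit{in}_A\cup\mathit{in}_B)\setminus\mathit{shared}(A,B)$, outputs $(\mathit{out}_A\cup\mathit{out}_B)\setminus\mathit{shared}(A,B)$, internal $\mathit{int}_A\cup\mathit{int}_B\cup\mathit{shared}(A,B)$; a non-shared action of one component moves only that component; a shared action $a$ yields $(s,t)\xrightarrow{a}(s',t')$ when $s\xrightarrow{a}_A s'$ and $t\xrightarrow{a}_B t'$. For a set $M$, $M^\rhd=\{a^\rhd\mid a\in M\}$ are fresh names. For $M\subseteq\mathit{out}_A$, $A^\rhd_M$ denotes $A$ with every action $a\in M$ renamed to $a^\rhd$ (an output action of $A^\rhd_M$); its internal actions are $\mathit{int}_A$. $A,B$ are asynchronously composable if composable and $\mathit{shared}(A,B)^\rhd\cap(\mathit{act}_A\cup\mathit{act}_B)=\emptyset$.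 Let $\mathit{out}_{AB}=\mathit{out}_A\cap\mathit{in}_B$ and $\mathit{out}_{BA}=\mathit{out}_B\cap\mathit{in}_A$. $\Omega(A)$ is the IOTS with states $(s,q)$, $s\in\mathit{states}_A$, $q\in\mathit{out}_{AB}^*$, initial $(\mathit{start}_A,\epsilon)$, inputs $\mathit{in}_A$, outputs $\mathit{out}_A$, internal actions $\mathit{int}_A\cup\mathit{out}_{AB}^\rhd$, transitions $(s,q)\xrightarrow{a}(s',q)$ if $s\xrightarrow{a}_A s'$, $a\notin\mathit{out}_{AB}$; $(s,q)\xrightarrow{a^\rhd}(s',qa)$ if $s\xrightarrow{a}_A s'$, $a\in\mathit{out}_{AB}$; $(s,aq)\xrightarrow{a}(s,q)$ for $a\in\mathit{out}_{AB}$. $\Omega(B)$ analogously with $\mathit{out}_{BA}$. IOTSes $C,D$ are weakly synchronously compatible if composable and for all $(s_C,s_D)\in\mathit{reach}(C\otimes D)$ and $a\in\mathit{out}_C\cap\mathit{in}_D$ with $s_C\xrightarrow{a}_C s_C'$ there exist $\bar s_D,s_D'$ with $s_D\ (\xrightarrow{\mathit{int}_D})^*_D\ \bar s_D\xrightarrow{a}_D s_D'$, and symmetrically with the roles of $C,D$ exchanged. Asynchronously composable $A,B$ are weakly asynchronously compatible if $\Omega(A)$ and $\Omega(B)$ are weakly synchronously compatible. *)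

(* Defs.v *)
From mathcomp Require Import all_boot.
From mathcomp Require Import boolp classical_sets.
From Stdlib Require Import Relation_Operators.

Set Implicit Arguments.
Unset Strict Implicit.
Unset Printing Implicit Defensive.

Local Open Scope classical_set_scope.

(* The data of an IOTS over a universe [Act] of action names.  The conditions
   on these data are in [is_iots]; they are kept apart so that the operations
   below are total; the lemmas [is_iots_*] show that they yield IOTSes, and
   [composable_rename*] that renaming A or B keeps them composable. *)
Record iots (Act : Type) := Iots {
  states : Type;
  start : states;
  inp : set Act;
  outp : set Act;
  intl : set Act;
  trans : states -> Act -> states -> Prop
}.

Arguments start {Act} i.
Arguments trans {Act} i _ _ _.

Definition act (Act : Type) (A : iots Act) : set Act :=
  inp A `|` outp A `|` intl A.

Record is_iots (Act : Type) (A : iots Act) : Prop := IsIots {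
  inp_outp_disj : inp A `&` outp A = set0;
  inp_intl_disj : inp A `&` intl A = set0;
  outp_intl_disj : outp A `&` intl A = set0;
  trans_act : forall s a s', trans A s a s' -> act A a
}.

(* s (-X->)^* s' in A *)
Definition steps (Act : Type) (A : iots Act) (X : set Act) :
    states A -> states A -> Prop :=
  clos_refl_trans_1n (states A) (fun s s' => exists2 a, X a & trans A s a s').

Arguments steps {Act} A X _ _.

Definition reach (Act : Type) (A : iots Act) : set (states A) :=
  [set s | steps A (act A) (start A) s].

Arguments reach {Act} A.

Definition shared (Act : Type) (A B : iots Act) : set Act :=
  (inp A `&` outp B) `|` (inp B `&` outp A).

Definition composable (Act : Type) (A B : iots Act) : Prop :=
  act A `&` act B = shared A B.

Inductive sync_trans (Act : Type) (A B : iots Act) :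
    states A * states B -> Act -> states A * states B -> Prop :=
| SyncLeft s s' t a : ~ shared A B a -> trans A s a s' ->
    sync_trans (s, t) a (s', t)
| SyncRight s t t' a : ~ shared A B a -> trans B t a t' ->
    sync_trans (s, t) a (s, t')
| SyncShared s s' t t' a : shared A B a -> trans A s a s' -> trans B t a t' ->
    sync_trans (s, t) a (s', t').

Definition sync (Act : Type) (A B : iots Act) : iots Act := {|
  states := states A * states B;
  start := (start A, start B);
  inp := (inp A `|` inp B) `\` shared A B;
  outp := (outp A `|` outp B) `\` shared A B;
  intl := intl A `|` intl B `|` shared A B;
  trans := @sync_trans Act A B
|}.

(* [rhd a] is the name usually written a^|>.  It lives in the same
   universe [Act]: the main theorem assumes [injective rhd], and freshness
   with respect to the actions of A and B is what [async_composable] says. *)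

Inductive rename_trans (Act : Type) (rhd : Act -> Act) (A : iots Act)
    (M : set Act) : states A -> Act -> states A -> Prop :=
| RenameIn s a s' : M a -> trans A s a s' -> rename_trans rhd M s (rhd a) s'
| RenameOut s a s' : ~ M a -> trans A s a s' -> rename_trans rhd M s a s'.

(* A^|>_M *)
Definition rename (Act : Type) (rhd : Act -> Act) (A : iots Act)
    (M : set Act) : iots Act := {|
  states := states A;
  start := start A;
  inp := inp A;
  outp := (outp A `\` M) `|` rhd @` M;
  intl := intl A;
  trans := @rename_trans Act rhd A M
|}.

Definition async_composable (Act : Type) (rhd : Act -> Act)
    (A B : iots Act) : Prop :=
  composable A B /\ rhd @` shared A B `&` (act A `|` act B) = set0.

(* out_AB; out_BA is [outto B A] *)
Definition outto (Act : Type) (A B : iots Act) : set Act := outp A `&` inp B.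

(* Queues are words over out_AB, as sequences over the subtype of Act
   given by that set. *)
Inductive Omega_trans (Act : Type) (rhd : Act -> Act) (A B : iots Act) :
    states A * seq (outto A B) -> Act -> states A * seq (outto A B) -> Prop :=
| OmegaMove s a s' q : ~ outto A B a -> trans A s a s' ->
    Omega_trans rhd (s, q) a (s', q)
| OmegaEnqueue s (a : outto A B) s' q : trans A s (\val a) s' ->
    Omega_trans rhd (s, q) (rhd (\val a)) (s', rcons q a)
| OmegaDequeue s (a : outto A B) q :
    Omega_trans rhd (s, a :: q) (\val a) (s, q).

(* Omega(A) as a partner of B; Omega(B) is [Omega rhd B A] *)
Definition Omega (Act : Type) (rhd : Act -> Act) (A B : iots Act) :
    iots Act := {|
  states := states A * seq (outto A B);
  start := (start A, [::]);
  inp := inp A;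
  outp := outp A;
  intl := intl A `|` rhd @` outto A B;
  trans := @Omega_trans Act rhd A B
|}.

Section WellFormedness.
Variables (Act : Type) (rhd : Act -> Act).
Implicit Types A B : iots Act.

Lemma sharedC A B : shared A B = shared B A.
Proof. by rewrite /shared setUC. Qed.

Lemma composableC A B : composable A B -> composable B A.
Proof. by rewrite /composable setIC sharedC. Qed.

Lemma async_composableC A B :
  async_composable rhd A B -> async_composable rhd B A.
Proof.
by case=> cAB dAB; split; [exact: composableC | rewrite sharedC setUC].
Qed.

Lemma disjE (X Y : set Act) a : X `&` Y = set0 -> X a -> Y a -> False.
Proof. by move=> XY Xa Ya; have : (X `&` Y) a by []; rewrite XY. Qed.

Lemma rhd_fresh A B a : async_composable rhd A B -> outto A B a ->
  ~ act A (rhd a) /\ ~ act B (rhd a).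
Proof.
move=> [_ d] [oa ib].
have sa : (rhd @` shared A B) (rhd a) by exists a => //; right.
by split=> h; apply: (disjE d sa); [left | right].
Qed.

Lemma is_iots_sync A B : is_iots A -> is_iots B -> composable A B ->
  is_iots (sync A B).
Proof.
move=> [a1 a2 a3 a4] [b1 b2 b3 b4] cAB.
have key a : act A a -> act B a -> shared A B a.
  by move=> Aa Ba; rewrite -cAB.
split=> /=.
- apply/seteqP; split=> // a /= [[ia na] [oa _]]; apply: na.
  case: ia oa => ia [] oa; first by case: (disjE a1 ia oa).
  + by left.
  + by right.
  + by case: (disjE b1 ia oa).
- apply/seteqP; split=> // a /= [[ia na] [[ja|ja]|//]]; apply: na.
  + case: ia => ia; first by case: (disjE a2 ia ja).
    by apply: key; [right | left; left].
  + case: ia => ia; last by case: (disjE b2 ia ja).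
    by apply: key; [left; left | right].
- apply/seteqP; split=> // a /= [[ia na] [[ja|ja]|//]]; apply: na.
  + case: ia => ia; first by case: (disjE a3 ia ja).
    by apply: key; [right | left; right].
  + case: ia => ia; last by case: (disjE b3 ia ja).
    by apply: key; [left; right | right].
- move=> s a s' h; case: (EM (shared A B a)) => [sa|na]; first by right; right.
  have [[[i|o]|j]|[[i|o]|j]] : act A a \/ act B a.
  + by case: h => [? ? ? ? _ /a4|? ? ? ? _ /b4|? ? ? ? ? _ /a4] ?;
      [left | right | left].
  + by left; left; split=> //; left.
  + by left; right; split=> //; left.
  + by right; left; left.
  + by left; left; split=> //; right.
  + by left; right; split=> //; right.
  + by right; left; right.
Qed.

Lemma is_iots_rename A (M : set Act) : is_iots A -> M `<=` outp A ->
  rhd @` M `&` act A = set0 -> is_iots (rename rhd A M).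
Proof.
move=> [a1 a2 a3 a4] MA d.
split=> //=.
- apply/seteqP; split=> // a /= [ia [[oa _]|Ma]]; first exact: disjE a1 ia oa.
  by apply: (disjE d Ma); left; left.
- apply/seteqP; split=> // a /= [[[oa _]|Ma] ia]; first exact: disjE a3 oa ia.
  by apply: (disjE d Ma); right.
- move=> s a s' [{}s {}a {}s' Ma _|{}s {}a {}s' Ma /a4].
    by left; right; right; exists a.
  by case=> [[|]|] ?; [left; left | left; right; left | right].
Qed.

Lemma is_iots_rename_outto A B : is_iots A -> async_composable rhd A B ->
  is_iots (rename rhd A (outto A B)).
Proof.
move=> hA hAB; apply: is_iots_rename => //; first by move=> a [].
apply/seteqP; split=> // _ [[a ha <-] /=].
by have [] := rhd_fresh hAB ha.
Qed.

Lemma is_iots_Omega A B : is_iots A -> async_composable rhd A B ->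
  is_iots (Omega rhd A B).
Proof.
move=> [a1 a2 a3 a4] hAB.
have fr a : (rhd @` outto A B) a -> ~ act A a.
  by case=> b hb <-; have [] := rhd_fresh hAB hb.
split=> //=.
- apply/seteqP; split=> // a /= [ia [ja|/fr]]; first exact: disjE a2 ia ja.
  by apply; left; left.
- apply/seteqP; split=> // a /= [ia [ja|/fr]]; first exact: disjE a3 ia ja.
  by apply; left; right.
- move=> _ a _ [s {}a s' q _ /a4|s {}a s' q _|s {}a q].
  + by case=> [[|]|] ?; [left; left | left; right | right; left].
  + by right; right; exists (\val a) => //; exact: set_valP.
  + by left; right; have [] := set_valP a.
Qed.

Lemma composable_rename A B : is_iots A -> async_composable rhd A B ->
  composable (rename rhd A (outto A B)) B.
Proof.
move=> [a1 a2 a3 _] hAB; have [cAB _] := hAB.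
have fr a : (rhd @` outto A B) a -> ~ act B a.
  by case=> b hb <-; have [] := rhd_fresh hAB hb.
have key a : act A a -> act B a -> shared A B a by move=> Aa Ba; rewrite -cAB.
have e1 a : inp A a -> outp A a -> False by exact: disjE.
have e3 a : outp A a -> intl A a -> False by exact: disjE.
apply/seteqP; split=> a.
- case=> Aa Ba; case: Aa => [[ia|[[oa nM]|/fr]]|ja] //.
  + have : shared A B a by apply: key => //; left; left.
    by case=> [[? ?]|[_ /(e1 _ ia)]] //; left.
  + have : shared A B a by apply: key => //; left; right.
    by case=> [[/e1 /(_ oa)]|[ib _]] //; case: nM.
  + have : shared A B a by apply: key => //; right.
    case=> [[ia _]|[_ oa]]; last by case: (e3 _ oa ja).
    by case: (disjE a2 ia ja).
- case=> [[ia ob]|[ib [[oa nM]|h]]].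
  + by split; left; [left | right].
  + by case: nM.
  + by case: (fr _ h); left; left.
Qed.

Lemma composable_rename_r A B : is_iots B -> async_composable rhd A B ->
  composable A (rename rhd B (outto B A)).
Proof.
move=> hB /async_composableC hBA.
by apply/composableC/composable_rename.
Qed.

End WellFormedness.

Definition weakly_sync_compatible (Act : Type) (C D : iots Act) : Prop :=
  [/\ composable C D,
      forall (sC : states C) (sD : states D), reach (sync C D) (sC, sD) ->
        forall a : Act, (outp C `&` inp D) a ->
        forall sC', trans C sC a sC' ->
        exists sD1 sD', steps D (intl D) sD sD1 /\ trans D sD1 a sD'
    & forall (sC : states C) (sD : states D), reach (sync C D) (sC, sD) ->
        forall a : Act, (outp D `&` inp C) a ->
        forall sD', trans D sD a sD' ->
        exists sC1 sC', steps C (intl C) sC sC1 /\ trans C sC1 a sC'].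

Definition weakly_async_compatible (Act : Type) (rhd : Act -> Act)
    (A B : iots Act) : Prop :=
  async_composable rhd A B /\
  weakly_sync_compatible (Omega rhd A B) (Omega rhd B A).

(* Main.v *)
(* In the composition of A with B^|>, the messages from B to A are no longer
   synchronised: B emits them freely as b^|> and A may receive them at any time.
   Hence that system over-approximates the asynchronous one in the direction
   from B to A.  In the direction from A to B, a reachable state ((sA, qA), (sB, qB))
   of the asynchronous system is matched by a reachable state (r, sB) of the
   composition of A with B^|> in which A lags behind: from r, A reaches sA while
   sending exactly the word qA still in transit.  If a is the head of qA, letting
   A run from r up to the emission of a gives a reachable state to which
   condition (a) applies. *)

Require Import Defs.
From mathcomp Require Import all_boot.
From mathcomp Require Import boolp classical_sets.
From Stdlib Require Import Relation_Operators Operators_Properties.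

Local Open Scope classical_set_scope.

Section Reachability.
Context {Act : Type}.
Implicit Types A B : iots Act.

Lemma reach_ind {A} (P : states A -> Prop) : P (start A) ->
  (forall s a s', P s -> trans A s a s' -> P s') ->
  forall s, reach A s -> P s.
Proof.
move=> P0 PS s h; elim: h P0 => // {}s s1 s2 [a _ t] _ IH Ps.
by apply: IH; apply: PS Ps t.
Qed.

Lemma reach_trans {A s a s'} : is_iots A ->
  reach A s -> trans A s a s' -> reach A s'.
Proof.
move=> hA rs t; apply: clos_rt_rt1n.
apply: rt_trans (clos_rt1n_rt _ _ _ _ rs) _.
by apply: rt_step; exists a => //; exact: trans_act t.
Qed.

Lemma reach_sync_swap {A B s t} : is_iots A -> is_iots B -> composable A B ->
  reach (sync A B) (s, t) -> reach (sync B A) (t, s).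
Proof.
move=> hA hB cAB.
have hBA := is_iots_sync hB hA (composableC cAB).
pose P (x : states (sync A B)) := reach (sync B A) (x.2, x.1).
apply: (@reach_ind (sync A B) P) => {s t}; first exact: rt1n_refl.
rewrite /P => x a x' r h; apply: (reach_trans (a := a) hBA r).
case: h => [*|*|{}s s' t t' {}a sh tA tB].
- by apply: SyncRight => //; rewrite sharedC.
- by apply: SyncLeft => //; rewrite sharedC.
- by apply: SyncShared => //; rewrite sharedC.
Qed.

(** All actions outside [M] count as silent, inputs as well as internal ones: next to the renamed
    partner, [A] takes its inputs alone. The word has type [seq M], so with [M] equal to [outto A B]
    it is directly comparable with a queue of [Omega]. *)
Inductive emits A (M : set Act) : states A -> seq M -> states A -> Prop :=
| EmitsNil s : emits A M s [::] s
| EmitsSilent s a s1 w s' : ~ M a -> trans A s a s1 -> emits A M s1 w s' ->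
    emits A M s w s'
| EmitsSend s (a : M) s1 w s' : trans A s (\val a) s1 -> emits A M s1 w s' ->
    emits A M s (a :: w) s'.

#[global] Arguments EmitsNil {A M} s.
#[global] Arguments EmitsSilent {A M s a s1 w s'} _ _ _.
#[global] Arguments EmitsSend {A M s a s1 w s'} _ _.

Lemma emits_cat {A M s w s1 w' s'} :
  emits A M s w s1 -> emits A M s1 w' s' -> emits A M s (w ++ w') s'.
Proof.
move=> h h'; elim: h h' => // {s w s1}.
- by move=> s a s1 w s2 nMa t _ IH /IH; exact: EmitsSilent nMa t.
- by move=> s a s1 w s2 t _ IH /IH; exact: EmitsSend t.
Qed.

Lemma emits_cons {A M s a w s'} : emits A M s (a :: w) s' ->
  exists r r', [/\ emits A M s [::] r, trans A r (\val a) r' & emits A M r' w s'].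
Proof.
move Ew: (a :: w) => v h; elim: h a w Ew => // {s v s'}.
- move=> s b s1 v s' nMb t _ IH a w /IH[r [r' [h1 h2 h3]]].
  by exists r, r'; split=> //; exact: EmitsSilent nMb t h1.
- by move=> s b s1 v s' t h _ a w [-> ->]; exists s, s1; split=> //; exact: EmitsNil.
Qed.

Lemma Omega_transP {rhd : Act -> Act} {A B s q a s' q'} :
  trans (Omega rhd A B) (s, q) a (s', q') ->
  [\/ [/\ ~ outto A B a, trans A s a s' & q' = q],
      exists b : outto A B,
        [/\ a = rhd (\val b), trans A s (\val b) s' & q' = rcons q b] |
      exists b : outto A B, [/\ a = \val b, s' = s & q = b :: q']].
Proof.
move=> h; inversion h; [exact: Or31|apply: Or32|apply: Or33].
- by exists a0.
- by exists a0.
Qed.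

(** Sending is never blocked in [Omega]: a renamed send becomes an enqueue, so the run can be
    replayed from any queue [q]. *)
Lemma Omega_lift_steps {rhd : Act -> Act} {A B s s1} q :
  steps (rename rhd A (outto A B)) (intl A `|` rhd @` outto A B) s s1 ->
  exists q1, steps (Omega rhd A B) (intl (Omega rhd A B)) (s, q) (s1, q1).
Proof.
move=> h; elim: h q => [{}s q|{}s s2 {}s1 [a Xa t] _ IH q].
  by exists q; exact: rt1n_refl.
have [q2 t2] : exists q2, trans (Omega rhd A B) (s, q) a (s2, q2).
  case: t Xa => {}s {}a s3 Ma t _.
  - have [b eb] : exists b : outto A B, \val b = a by exists (SigSub (mem_set Ma)).
    rewrite -eb in t *.
    by exists (rcons q b); exact: OmegaEnqueue.
  - by exists q; exact: OmegaMove.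
have [q1 h1] := IH q2.
by exists q1; apply: Relation_Operators.rt1n_trans h1; exists a.
Qed.

End Reachability.

Section Omega.
Context {Act : Type} {rhd : Act -> Act} (rhd_inj : injective rhd).
Context {A B : iots Act}.
Hypotheses (hA : is_iots A) (hB : is_iots B) (hAB : async_composable rhd A B).

Local Notation OA := (Omega rhd A B).
Local Notation OB := (Omega rhd B A).
Local Notation rB := (rename rhd B (outto B A)).

Let fresh_AB {a} : outto A B a -> ~ act A (rhd a) /\ ~ act B (rhd a).
Proof. exact: rhd_fresh. Qed.

Let fresh_BA {a} : outto B A a -> ~ act A (rhd a) /\ ~ act B (rhd a).
Proof. by move=> /(rhd_fresh (async_composableC hAB))[]. Qed.

Lemma outto_asym {a} : outto A B a -> ~ outto B A a.
Proof. by move=> [oA _] [_ iA]; exact: disjE (inp_outp_disj hA) iA oA. Qed.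

(** Freshness separates the enqueue names from all actions of [A] and [B]; injectivity of [rhd]
    separates the two families of enqueue names from each other, since [outto A B] and [outto B A]
    are disjoint. *)
Lemma composable_Omega : composable OA OB.
Proof.
have cAB : act A `&` act B = shared A B by case: hAB.
apply/seteqP; split=> a; last first.
  by rewrite /shared /= => -[[iA oB]|[iB oA]]; split; left; [left|right|right|left].
have key : act A a \/ (rhd @` outto A B) a -> act B a \/ (rhd @` outto B A) a ->
    shared A B a.
  move=> [Aa|[b hb <-]] [Ba|[c hc e]].
  - by rewrite -cAB.
  - by move: Aa; rewrite -e => /(proj1 (fresh_BA hc)).
  - by move: Ba => /(proj2 (fresh_AB hb)).
  - by move: hc; rewrite (rhd_inj _ _ e) => /(outto_asym hb).
case=> /= Aa Ba; apply: key.
- by case: Aa => [|[|]] ?; [left; left|left; right|right].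
- by case: Ba => [|[|]] ?; [left; left|left; right|right].
Qed.

(** Renaming removes every output of [B] that [A] could receive, and the fresh names are no inputs
    of [A]. *)
Lemma shared_renameE : shared A rB = outto A B.
Proof.
apply/seteqP; split=> a; last by case=> oA iB; right.
case=> [[iA [[oB nM]|[b hb e]]]|[iB oA]] //.
- by case: nM.
- by case: (fresh_BA hb) => + _; case; left; left; rewrite e.
Qed.

Lemma is_iots_sync_rename : is_iots (sync A rB).
Proof.
apply: is_iots_sync => //; last exact: composable_rename_r.
exact: is_iots_rename_outto (async_composableC hAB).
Qed.

(** The steps of a run emitting the empty word are not shared, so [A] takes them alone. *)
Lemma reach_rename_emits {r sB r'} : reach (sync A rB) (r, sB) ->
  emits A (outto A B) r [::] r' -> reach (sync A rB) (r', sB).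
Proof.
move Ew: [::] => w + h; elim: h Ew => // {r w r'} s a s1 w s' na t _ IH /IH{}IH rs.
apply: IH; apply: (reach_trans is_iots_sync_rename rs).
by apply: SyncLeft t; rewrite shared_renameE.
Qed.

Definition lags (x : states (sync OA OB)) : Prop :=
  exists2 r, reach (sync A rB) (r, x.2.1) & emits A (outto A B) r x.1.2 x.1.1.

(** Steps of [A] extend the run at its end, steps of [B] are copied by [rB], and the witness [r]
    advances only when [B] receives a message of [A]. *)
Lemma reach_lags {x} : reach (sync OA OB) x -> lags x.
Proof.
have shE a : shared OA OB a = shared A B a by [].
have shA a : shared A B a -> act A a.
  by move=> [[iA _]|[_ oA]]; left; [left|right].
have reachB r sB c sB' : reach (sync A rB) (r, sB) -> ~ outto A B c ->
    trans rB sB c sB' -> reach (sync A rB) (r, sB').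
  move=> rr nc t; apply: (reach_trans is_iots_sync_rename rr).
  by apply: SyncRight t; rewrite shared_renameE.
have silentA r c sA sA' q : ~ outto A B c -> trans A sA c sA' ->
    emits A (outto A B) r q sA -> emits A (outto A B) r q sA'.
  move=> na t /emits_cat e; rewrite -[q]cats0; apply: e.
  by apply: EmitsSilent na t _; exact: EmitsNil.
apply: reach_ind => [|x0 a x1 [r rr em] h].
  by exists (start A); [exact: rt1n_refl|exact: EmitsNil].
case: h rr em => {x0 x1} [[sA qA] [sA' qA'] [sB qB] {}a|
    [sA qA] [sB qB] [sB' qB'] {}a|[sA qA] [sA' qA'] [sB qB] [sB' qB'] {}a];
  rewrite shE => sh.
- move=> /Omega_transP[[na t ->]|[b [_ t ->]]|[b [ab _ _]]] /= rr em.
  + by exists r => //; exact: silentA na t em.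
  + exists r => //=; rewrite -cats1; apply: (emits_cat em).
    by apply: (EmitsSend t); exact: EmitsNil.
  + by case: sh; right; rewrite ab; have [] := set_valP b.
- move=> /Omega_transP[[na t _]|[b [_ t _]]|[b [ab _ _]]] /= rr em.
  + exists r => //; apply: reachB rr _ _; last exact: RenameOut t.
    by move=> [oA iB]; apply: sh; right.
  + exists r => //; apply: reachB rr _ (RenameIn rhd (set_valP b) t).
    by move=> [oA _]; case: (fresh_BA (set_valP b)); case; left; right.
  + by case: sh; left; rewrite ab; have [] := set_valP b.
- move=> /Omega_transP[[na tA ->]|[b [ab _ _]]|[b [ab -> ->]]];
    move=> /Omega_transP[[nb tB _]|[c [ac _ _]]|[c [ac -> _]]] /= rr em.
  + by case: sh => -[? ?]; [case: nb|case: na].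
  + by case: (fresh_BA (set_valP c)); rewrite -ac => /(_ (shA _ sh)).
  (* [A] receives a message from the queue of [B]: a silent step at the end of the run, with the
     state of [B] unchanged. *)
  + by exists r => //; exact: silentA na tA em.
  1-3: by case: (fresh_AB (set_valP b)); rewrite -ab => /(_ (shA _ sh)).
  (* [B] receives the head of the queue of [A]: the witness catches up to [r2], just after the
     emission of that letter, and the rest of the run emits the remaining queue. *)
  + have [r1 [r2 [e1 t e2]]] := emits_cons em.
    exists r2 => //=; rewrite -ab in t.
    apply: (reach_trans is_iots_sync_rename (reach_rename_emits rr e1)).
    apply: SyncShared t _; last exact: RenameOut.
    by rewrite shared_renameE ab; exact: set_valP.
  + by case: (fresh_BA (set_valP c)); rewrite -ac => /(_ (shA _ sh)).
  + by case: (outto_asym (set_valP b)); rewrite -ab ac; exact: set_valP.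
Qed.

Lemma Omega_accepts {x y a x'} :
  (forall sA sB, reach (sync A rB) (sA, sB) ->
    forall c, outto A B c -> forall sA', trans A sA c sA' ->
    exists sB1 sB', steps rB (intl B `|` rhd @` outto B A) sB sB1 /\
      trans B sB1 c sB') ->
  reach (sync OA OB) (x, y) -> outto A B a -> trans OA x a x' ->
  exists y1 y', steps OB (intl OB) y y1 /\ trans OB y1 a y'.
Proof.
case: x x' y => [sA qA] [sA' qA'] [sB qB] cond /reach_lags[r /= rr em] Ma.
(* As [a] lies in [outto A B], it is neither a plain move nor a fresh name; hence it is the head of
   [qA]. *)
move=> /Omega_transP[[]//|[b [ab _ _]]|[b [ab _ eq]]].
  by case: (fresh_AB (set_valP b)); rewrite -ab; case; left; right; case: Ma.
rewrite eq in em; have [r1 [r2 [e1 t _]]] := emits_cons em.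
rewrite -ab in t.
have [sB1 [sB' [h1 t1]]] := cond _ _ (reach_rename_emits rr e1) _ Ma _ t.
have [q1 h] := Omega_lift_steps qB h1.
(* Receiving [a] leaves the queue [q1] unchanged, because [a] is not a message from [B] to [A]. *)
by exists (sB1, q1), (sB', q1); split=> //; apply: OmegaMove t1; exact: outto_asym.
Qed.

End Omega.

Theorem theorem5p3 (Act : Type) (rhd : Act -> Act) (rhd_inj : injective rhd)
    (A B : iots Act) (hA : is_iots A) (hB : is_iots B)
    (hAB : async_composable rhd A B)
    (condA : forall (sA : states A) (sB : states B),
      reach (sync A (rename rhd B (outto B A))) (sA, sB) ->
      forall a : Act, outto A B a ->
      forall sA' : states A, trans A sA a sA' ->
      exists sB1 sB' : states B,
        steps (rename rhd B (outto B A))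
          (intl B `|` rhd @` outto B A) sB sB1 /\ trans B sB1 a sB')
    (condB : forall (sA : states A) (sB : states B),
      reach (sync (rename rhd A (outto A B)) B) (sA, sB) ->
      forall b : Act, outto B A b ->
      forall sB' : states B, trans B sB b sB' ->
      exists sA1 sA' : states A,
        steps (rename rhd A (outto A B))
          (intl A `|` rhd @` outto A B) sA sA1 /\ trans A sA1 b sA') :
  weakly_async_compatible rhd A B.
Proof.
have hBA := async_composableC hAB; have cAB := composable_Omega rhd_inj hA hAB.
split=> //; split=> // [x y rxy a Ma x' t|x y rxy a Ma y' t].
  exact: Omega_accepts condA rxy Ma t.
(* [Omega_accepts] is used with [A] and [B] exchanged, whereas condition (b) keeps [A] as the left
   component; hence both swaps. *)
have ryx := reach_sync_swap (is_iots_Omega hA hAB) (is_iots_Omega hB hBA) cAB rxy.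
apply: Omega_accepts _ ryx Ma t => // sB sA r; apply: condB.
apply: reach_sync_swap r => //; first exact: is_iots_rename_outto.
exact: composable_rename_r.
Qed.
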